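(* Let $\alpha\in(0,1]$ and let $\mathcal C=(\mathcal C_t)_{t\ge0}$ be any candidate-family process. For finite nonempty $S\subseteq\mathcal I$ put $$E_t^{S,\mathrm{can}}=\frac1\alpha\max_{R\in\mathcal C_t}\mathrm{FDP}_{S\cap I_t}(R),\qquad \overline E_t^{S,\mathrm{can}}=\max_{0\le u\le t}E_u^{S,\mathrm{can}} .$$ (a) If $\mathbf E=(E^S_t)$ is a future-extension coherent dynamic intersection $e$-process collection and $\mathcal C_t\subseteq\mathfrak R_{\alpha,t}(\mathbf E)$ for every $t$, then $E_t^{S,\mathrm{can}}\le E_t^S$ for every finite nonempty $S$ and every $t$. (b) If, in addition, $\mathbf E$ is time-monotone, then $\overline E_t^{S,\mathrm{can}}\le E_t^S$ for every finite nonempty $S$ and every $t$.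
   Context: Let $(\Omega,\mathcal F,(\mathcal F_t)_{t\in\mathbb N_0})$ be a discrete-time filtered measurable space, $\mathcal M$ a family of probability measures on $(\Omega,\mathcal F)$, $\mathcal I\subseteq\mathbb N$ an index set (finite or infinite), and $H_i\subseteq\mathcal M$, $i\in\mathcal I$, null hypotheses. For finite $S\subseteq\mathcal I$, $H_S=\bigcap_{i\in S}H_i$ (with $H_\varnothing=\mathcal M$). The active sets $I_t\subseteq\mathcal I$ are deterministic and finite with $I_0\subseteq I_1\subseteq\cdots$ and $\bigcup_t I_t=\mathcal I$. For a finite $R\subseteq\mathcal I$ and any $S\subseteq\mathcal I$, $\mathrm{FDP}_S(R)=|S\cap R|/(|R|\vee 1)$. A candidate-family process $\mathcal C=(\mathcal C_t)_{t\ge0}$ consists of nonempty random families $\mathcal C_t\subseteq 2^{I_t}$ with $\{R\in\mathcal C_t\}\in\mathcal F_t$ for every deterministic $R\subseteq I_t$. A nonnegative $(\mathcal F_t)$-adapted process $E=(E_t)_{t\ge0}$ is an $e$-process for $H\subseteq\mathcal M$ if $\mathbb E_P[E_\tau]\le1$ for every $P\in H$ and every $(\mathcal F_t)$-stopping time $\tau$ with $P(\tau<\infty)=1$. A dynamic intersection $e$-process collection is a family $\mathbf E=(E^S_t)_{t\ge0,\ S\subseteq\mathcal I,\ 0<|S|<\infty}$ such that $E^S$ is an $e$-process for $H_S$ for each nonempty finite $S$. It is future-extension coherent if, pointwise on $\Omega$, $E_t^{S\cap I_t}\le E_t^S$ for every $t$ and every finite $S$ with $S\cap I_t\ne\varnothing$.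 It is time-monotone if, pointwise on $\Omega$, $E^S_t\le E^S_u$ for all $t\le u$ and every finite nonempty $S$. The closure family at time $t$ is $\mathfrak R_{\alpha,t}(\mathbf E)=\{R\subseteq I_t:\ \mathrm{FDP}_S(R)\le\alpha E^S_t\text{ for every nonempty }S\subseteq I_t\}$. Inclusions and inequalities are pointwise on $\Omega$. *)

(* Defs.v *)
From HB Require Import structures.
From mathcomp Require Export all_boot all_order all_algebra finmap.
From mathcomp Require Export all_classical all_reals all_analysis
  measurable_realfun.
Export Order.TTheory GRing.Theory Num.Theory.

Set Implicit Arguments.
Unset Strict Implicit.
Unset Printing Implicit Defensive.

Local Open Scope classical_set_scope.
Local Open Scope ring_scope.

Section FilteredSpace.
Context (d : measure_display) (Omega : measurableType d).

Definition filtration (F : nat -> set (set Omega)) : Prop :=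
  [/\ forall t, sigma_algebra setT (F t),
      forall t, F t `<=` measurable
    & forall s t, (s <= t)%N -> F s `<=` F t].

(* Times take values in N u {oo}; [None] stands for oo. *)
Definition stopping_time (F : nat -> set (set Omega))
    (tau : Omega -> option nat) : Prop :=
  forall t, F t [set w | exists2 s, tau w = Some s & (s <= t)%N].

Definition adapted (R : realType) (F : nat -> set (set Omega))
    (E : nat -> Omega -> \bar R) : Prop :=
  forall t (Y : set (\bar R)), measurable Y -> F t (E t @^-1` Y).

(* [E_tau]; its value on the event tau = oo is immaterial below, where that
   event is null. *)
Definition stopped (R : realType) (E : nat -> Omega -> \bar R)
    (tau : Omega -> option nat) : Omega -> \bar R :=
  fun w => if tau w is Some t then E t w else 0%E.

(* Values in [0, +oo] are allowed, so the expectation is written as an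
   integral ('E_P is only available for real-valued functions). *)
Definition e_process (R : realType) (F : nat -> set (set Omega))
    (H : set (probability Omega R)) (E : nat -> Omega -> \bar R) : Prop :=
  [/\ forall t w, (0 <= E t w)%E,
      adapted F E
    & forall P, H P -> forall tau, stopping_time F tau ->
        P [set w | tau w <> None] = 1%E ->
        (\int[P]_w stopped E tau w <= 1)%E].

End FilteredSpace.

Section ActiveSets.

(* Deterministic finite nondecreasing sets exhausting the index set. *)
Definition active_sets (Idx : set nat) (Act : nat -> {fset nat}) : Prop :=
  (forall s t, (s <= t)%N -> (Act s `<=` Act t)%fset) /\
  \bigcup_t [set` Act t] = Idx.

Definition fin_nonempty_sub (Idx : set nat) (S : {fset nat}) : Prop :=
  S != fset0 /\ [set` S] `<=` Idx.

Definition intersection_hyp (T : Type) (M : set T) (H : nat -> set T)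
    (S : {fset nat}) : set T :=
  M `&` \bigcap_(i in [set` S]) H i.

Definition FDP (R : realType) (S : set nat) (A : {fset nat}) : R :=
  #|` [fset i in A | i \in S]%fset|%:R / (maxn #|` A| 1)%:R.

End ActiveSets.

Section Processes.
Context (d : measure_display) (Omega : measurableType d) (R : realType).
Implicit Types (F : nat -> set (set Omega)) (Idx : set nat)
  (Act : nat -> {fset nat}) (E : {fset nat} -> nat -> Omega -> \bar R)
  (C : nat -> Omega -> {fset {fset nat}}).

Definition candidate_family_process F Act C : Prop :=
  [/\ forall t w, C t w != fset0,
      forall t w (A : {fset nat}), A \in C t w -> (A `<=` Act t)%fset
    & forall t (A : {fset nat}), (A `<=` Act t)%fset ->
        F t [set w | A \in C t w]].

(* A collection indexed by the nonempty finite subsets of [Idx] is given by a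
   function on all finite sets; its other values are never constrained. *)
Definition dynamic_e_collection F (M : set (probability Omega R))
    (H : nat -> set (probability Omega R)) Idx E : Prop :=
  forall S, fin_nonempty_sub Idx S ->
    e_process F (intersection_hyp M H S) (E S).

Definition future_extension_coherent Idx Act E : Prop :=
  forall t (S : {fset nat}), [set` S] `<=` Idx ->
    (S `&` Act t)%fset != fset0 ->
    forall w, (E (S `&` Act t)%fset t w <= E S t w)%E.

Definition time_monotone Idx E : Prop :=
  forall t u, (t <= u)%N -> forall S, fin_nonempty_sub Idx S ->
    forall w, (E S t w <= E S u w)%E.

Definition closure_family (alpha : R) Act E (t : nat) (w : Omega)
    : set {fset nat} :=
  [set A | (A `<=` Act t)%fset /\
    forall S : {fset nat}, S != fset0 -> (S `<=` Act t)%fset ->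
      ((FDP R [set` S] A)%:E <= alpha%:E * E S t w)%E].

(* The maxima below range over nonempty finite families of nonnegative
   numbers, so the default value 0 of the iterated maximum plays no role. *)
Definition canonical_e (alpha : R) Act C (S : {fset nat}) (t : nat)
    (w : Omega) : R :=
  alpha^-1 *
    \big[Num.max/0]_(A <- enum_fset (C t w)) FDP R [set` (S `&` Act t)%fset] A.

Definition running_canonical_e (alpha : R) Act C (S : {fset nat}) (t : nat)
    (w : Omega) : R :=
  \big[Num.max/0]_(u < t.+1) canonical_e alpha Act C S u w.

End Processes.

(* Main.v *)
Require Import Defs.

Local Open Scope classical_set_scope.
Local Open Scope ring_scope.

(** The bound holds term by term in the maximum.  Fix [S], [t] and a candidate
    set [A] in the family at time [t], and put [S' = S `&` Act t].  If [S'] is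
    nonempty it is one of the test sets of the closure family, so membership of
    [A] gives FDP_S'(A) <= alpha E_t^S', and coherence raises E_t^S' to E_t^S.
    If [S'] is empty then FDP_S'(A) is 0, and nonnegativity of E^S suffices.
    Since alpha E_t^S does not depend on [A], it also bounds the maximum over
    [A]; dividing by alpha > 0 gives the first part ([canonical_e_le]).  For
    the second part, time-monotonicity bounds each of the earlier canonical
    values by E_u^S <= E_t^S, hence also their maximum. *)

Lemma FDP_set0 (R : realType) (S : {fset nat}) (A : {fset nat}) :
  S = fset0 -> FDP R [set` S] A = 0.
Proof.
move=> ->; rewrite /FDP.
suff -> : [fset i in A | i \in [set` (fset0 : {fset nat})]]%fset = fset0.
  by rewrite cardfs0 mul0r.
by apply/fsetP => i; rewrite !inE /= mem_setE in_fset0 andbF.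
Qed.

(** The maximum is of reals while the bound [b] may be +oo, so the comparison
    cannot be made in [R]; [0 <= b] accounts for the initial value 0. *)
Lemma EFin_bigmax_le (R : realType) (I : eqType) (s : seq I) (f : I -> R)
    (b : \bar R) :
  (0 <= b)%E -> (forall i, i \in s -> ((f i)%:E <= b)%E) ->
  ((\big[Num.max/0]_(i <- s) f i)%:E <= b)%E.
Proof.
move=> b0 fb; rewrite big_seq.
elim/big_ind: _ => // x y xb yb.
by rewrite EFin_max ge_max xb yb.
Qed.

(** A fixed candidate set: intersecting with the active set makes [S] a
    legitimate test set of the closure family, and coherence returns to [S]. *)
Lemma FDP_le_closure (R : realType) (d : measure_display)
    (Omega : measurableType d) (Idx : set nat) (Act : nat -> {fset nat})
    (alpha : R) (E : {fset nat} -> nat -> Omega -> \bar R)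
    (S A : {fset nat}) (t : nat) (w : Omega) :
  0 < alpha -> future_extension_coherent Idx Act E ->
  [set` S] `<=` Idx -> (0 <= E S t w)%E ->
  closure_family alpha Act E t w A ->
  ((FDP R [set` (S `&` Act t)%fset] A)%:E <= alpha%:E * E S t w)%E.
Proof.
move=> alpha0 hcoh SI E0 [_ hA].
have [S0|S0] := eqVneq (S `&` Act t)%fset fset0.
  by rewrite FDP_set0 // mule_ge0 // lee_fin ltW.
apply: le_trans (hA _ S0 (fsubsetIr _ _)) _.
by apply: lee_wpmul2l; [rewrite lee_fin ltW|exact: hcoh].
Qed.

Lemma canonical_e_le (R : realType) (d : measure_display)
    (Omega : measurableType d) (Idx : set nat) (Act : nat -> {fset nat})
    (alpha : R) (C : nat -> Omega -> {fset {fset nat}})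
    (E : {fset nat} -> nat -> Omega -> \bar R)
    (S : {fset nat}) (t : nat) (w : Omega) :
  0 < alpha -> future_extension_coherent Idx Act E ->
  [set` S] `<=` Idx -> (0 <= E S t w)%E ->
  [set` C t w] `<=` closure_family alpha Act E t w ->
  ((canonical_e alpha Act C S t w)%:E <= E S t w)%E.
Proof.
move=> alpha0 hcoh SI E0 hCE.
rewrite /canonical_e EFinM lee_pdivrMl //.
apply: EFin_bigmax_le => [|A AC]; first by rewrite mule_ge0 // lee_fin ltW.
by apply: FDP_le_closure hcoh SI E0 _ => //; exact: hCE.
Qed.

Theorem theorem7p3 (R : realType) (d : measure_display)
    (Omega : measurableType d) (F : nat -> set (set Omega))
    (hF : filtration F)
    (M : set (probability Omega R)) (Idx : set nat)
    (H : nat -> set (probability Omega R))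
    (hH : forall i, Idx i -> H i `<=` M)
    (Act : nat -> {fset nat}) (hAct : active_sets Idx Act)
    (alpha : R) (halpha : 0 < alpha <= 1)
    (C : nat -> Omega -> {fset {fset nat}})
    (hC : candidate_family_process F Act C)
    (E : {fset nat} -> nat -> Omega -> \bar R)
    (hE : dynamic_e_collection F M H Idx E)
    (hcoh : future_extension_coherent Idx Act E)
    (hCE : forall t w, [set` C t w] `<=` closure_family alpha Act E t w) :
  (forall (S : {fset nat}) (t : nat) (w : Omega), fin_nonempty_sub Idx S ->
     ((canonical_e alpha Act C S t w)%:E <= E S t w)%E) /\
  (time_monotone Idx E ->
   forall (S : {fset nat}) (t : nat) (w : Omega), fin_nonempty_sub Idx S ->
     ((running_canonical_e alpha Act C S t w)%:E <= E S t w)%E).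
Proof.
have /andP[alpha0 _] := halpha.
have E0 S t w : fin_nonempty_sub Idx S -> (0 <= E S t w)%E.
  by move=> /hE[].
have canE S t w : fin_nonempty_sub Idx S ->
    ((canonical_e alpha Act C S t w)%:E <= E S t w)%E.
  move=> hS; have [_ SI] := hS.
  by apply: canonical_e_le hcoh SI _ _ => //; exact: E0.
split=> // hmono S t w hS.
apply: EFin_bigmax_le => [|u _]; first exact: E0.
by apply: le_trans (canE _ _ _ hS) (hmono _ _ _ _ hS _); rewrite -ltnS.
Qed.
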